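(* Let $q\ge2$ be the number of stages of the Radau IIA method. For each $n$, with $\mathbf n=(n,n)$, let $h=h_{\mathbf n}>0$ be the space discretization parameter ($h\to0$ as $n\to\infty$), let $\tau=\tau_{\mathbf n}>0$ be the time step, and let $M$ and $K$ be the Toeplitz mass and stiffness matrices of order $n^2$ defined in the context. Suppose that $\tau$ and $h$ satisfy the order condition of optimal balancing $\tau^{2q-1}\sim h^2$. Then the spectral symbol $s$ of the matrix-sequence $\{\tau M^{-1}K\}_{\mathbf n}$ is $s=+\infty$ (i.e. for every $R>0$, the number of eigenvalues of $\tau M^{-1}K$ not exceeding $R$ is $o(n^2)$ as $n\to\infty$), so that $$\{\mathcal{P}_L^{-1}\mathcal{A}\}_{\mathbf n}\sim_\lambda I_q,$$ that is, the preconditioned matrix-sequence $\{\mathcal{P}_L^{-1}\mathcal{A}\}_{\mathbf n}$ is spectrally clustered at $1$.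
   Context: Matrices $M$ and $K$. For a trigonometric polynomial $g$ in $\theta_1,\theta_2$ with Fourier coefficients $\hat g_{\bm k}=\frac1{(2\pi)^2}\int_{[-\pi,\pi]^2}g(\bm\theta)e^{-\mathrm{i}\,\bm k\cdot\bm\theta}d\bm\theta$, $\bm k\in\mathbb{Z}^2$, the two-level Toeplitz matrix generated by $g$ is $T_{\mathbf n}(g)=(\hat g_{\bm i-\bm j})_{\bm i,\bm j}$, where $\bm i,\bm j$ range over $\{1,\dots,n\}^2$ in lexicographic order. It is assumed that $M=T_{\mathbf n}(g_1)$ and $h^2K=T_{\mathbf n}(g_2)$, where $g_1$ is a strictly positive trigonometric polynomial in $\theta_1,\theta_2$ (such that $M$ is real symmetric positive definite), independent of $n$, and $g_2(\theta_1,\theta_2)=4-2\cos(\theta_1)-2\cos(\theta_2)$. Preconditioned matrix. $A_q\in\mathbb{R}^{q\times q}$ is the Runge-Kutta matrix of the $q$-stage Radau IIA method: $c_1<\dots<c_q=1$ are the zeros of $\frac{d^{q-1}}{dx^{q-1}}\left(x^{q-1}(x-1)^q\right)$ and $(A_q)_{ij}=\int_0^{c_i}p_j(x)\,dx$, where $p_j$ is the Lagrange basis polynomial of degree $q-1$ with $p_j(c_k)=\delta_{jk}$. One factorizes $A_q^{-1}=L_qU_q$ with $L_q$ lower triangular (with positive diagonal entries) and $U_q$ upper triangular with unit diagonal. With $\otimes$ the Kronecker product, $$\mathcal{A}=A_q^{-1}\otimes M+\tau I_q\otimes K,\qquad \mathcal{P}_L=L_q\otimes M+\tau I_q\otimes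 K .$$ Conventions. $\tau^{2q-1}\sim h^2$ means that there are constants $0<c\le C$ independent of $n$ with $c\,h^2\le\tau^{2q-1}\le C\,h^2$. For a sequence $\{X_{\mathbf n}\}_{\mathbf n}$ of square matrices of order $d_{\mathbf n}\to\infty$, $\{X_{\mathbf n}\}_{\mathbf n}\sim_\lambda I_q$ means that $\frac1{d_{\mathbf n}}\sum_{k=1}^{d_{\mathbf n}}F(\lambda_k(X_{\mathbf n}))\to F(1)$ for every continuous compactly supported $F$ on $\mathbb{C}$, where $\lambda_k(X_{\mathbf n})$ are the eigenvalues of $X_{\mathbf n}$. The sequence is spectrally clustered at $1$ if for every $\epsilon>0$ the number of eigenvalues of $X_{\mathbf n}$ with $|\lambda-1|\ge\epsilon$ is $o(d_{\mathbf n})$. *)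

(* Defs.v *)
From HB Require Import structures.
From mathcomp Require Import all_boot all_order all_algebra.
From mathcomp Require Import all_classical all_reals all_analysis.
From mathcomp.real_closed Require Import complex mxtens.

Set Implicit Arguments.
Unset Strict Implicit.
Unset Printing Implicit Defensive.

Import Order.TTheory GRing.Theory Num.Theory.
Import numFieldNormedType.Exports.

Local Open Scope classical_set_scope.
Local Open Scope complex_scope.
Local Open Scope ring_scope.

Section TwoLevelToeplitz.
Variable R : realType.

Definition expi (t : R) : R[i] := cos t +i* sin t.

Definition phase (k : int * int) (x : R * R) : R :=
  k.1%:~R * x.1 + k.2%:~R * x.2.

Definition trigpoly (g : R * R -> R[i]) : Prop :=
  exists (s : seq (int * int)) (a : int * int -> R[i]),
    forall x, g x = \sum_(k <- s) a k * expi (phase k x).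

Definition cintegral d (T : measurableType d) (mu : {measure set T -> \bar R})
    (D : set T) (f : T -> R[i]) : R[i] :=
  (\int[mu]_(x in D) complex.Re (f x))%R +i*
  (\int[mu]_(x in D) complex.Im (f x))%R.

Definition fourier_coef (g : R * R -> R[i]) (k : int * int) : R[i] :=
  (((2 * pi) ^+ 2)^-1)%:C *
  cintegral (@lebesgue_measure R \x @lebesgue_measure R)%E
    (`[- pi, pi] `*` `[- pi, pi]) (fun x => g x * expi (- phase k x)).

(* [mxtens_unindex] decodes a position in 'I_(n * n) as the pair of indices
   having that lexicographic rank, the first index varying slowest; this is
   also the block structure of the Kronecker product [*t]. *)
Definition toeplitz2 (n : nat) (g : R * R -> R[i]) : 'M[R[i]]_(n * n) :=
  \matrix_(i, j)
    let: (i1, i2) := mxtens_unindex i in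
    let: (j1, j2) := mxtens_unindex j in
    fourier_coef g ((i1 : nat)%:Z - (j1 : nat)%:Z,
                    (i2 : nat)%:Z - (j2 : nat)%:Z).

Definition laplace_symbol (x : R * R) : R[i] :=
  (4 - 2 * cos x.1 - 2 * cos x.2)%:C.

End TwoLevelToeplitz.

Section RadauIIA.
Variables (R : realType) (q : nat).

Definition radau_poly : {poly R} :=
  ('X^(q.-1) * ('X - 1%:P) ^+ q)^`(q.-1).

Definition radau_nodes (c : 'I_q -> R) : Prop :=
  [/\ forall i j : 'I_q, (i < j)%N -> c i < c j,
      forall x, root radau_poly x <-> exists i, c i = x &
      forall i : 'I_q, i.+1 = q -> c i = 1].

Definition lagrange_basis (c : 'I_q -> R) (j : 'I_q) : {poly R} :=
  \prod_(k < q | k != j) ((c j - c k)^-1 *: ('X - (c k)%:P)).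

Definition collocation_mx (c : 'I_q -> R) : 'M[R]_q :=
  \matrix_(i, j) (\int[lebesgue_measure]_(x in `[0%R, c i])
                    (lagrange_basis c j).[x])%R.

(* [is_trig_mx] means lower triangular. *)
Definition crout_LU (A L U : 'M[R]_q) : Prop :=
  [/\ A = L *m U,
      is_trig_mx L,
      forall i, 0 < L i i,
      is_trig_mx U^T &
      forall i, U i i = 1].

End RadauIIA.

Section Preconditioning.
Variables (R : realType) (q m : nat).

Definition stage_mx (B : 'M[R]_q) (M K : 'M[R]_m) (tau : R) : 'M[R]_(q * m) :=
  B *t M + tau *: (1%:M *t K).

End Preconditioning.

Definition spd (R : realType) (m : nat) (A : 'M[R]_m) : Prop :=
  A^T = A /\ forall x : 'cV[R]_m, x != 0 -> 0 < (x^T *m A *m x) 0 0.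

Section Spectrum.
Variable R : realType.

(* The eigenvalues of a real matrix, listed with algebraic multiplicity. *)
Definition eigenvalues (m : nat) (A : 'M[R]_m) : seq R[i] :=
  sval (closed_field_poly_normal (char_poly (map_mx (real_complex R) A))).

Variables (d : nat -> nat) (X : forall n, 'M[R]_(d n)).

(* Intended for matrices with real spectrum, where [complex.Re z] is the
   eigenvalue itself. *)
Definition symbol_pinfty : Prop :=
  forall r : R,  0 < r ->
    (count (fun z => complex.Re z <= r) (eigenvalues (X n)))%:R
      / (d n)%:R @[n --> \oo] --> (0 : R).

(* [R[i]^o] is the complex plane with the topology of its modulus. *)
Definition spectral_dist_one : Prop :=
  forall F : R[i]^o -> R[i]^o,
    continuous F -> compact (closure [set z | F z != 0]) ->
    (\sum_(z <- eigenvalues (X n)) F z) / (d n)%:R @[n --> \oo] --> F 1.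

Definition clustered_at_one : Prop :=
  forall eps : R, 0 < eps ->
    (count (fun z => eps%:C <= `|z - 1|) (eigenvalues (X n)))%:R
      / (d n)%:R @[n --> \oo] --> (0 : R).

End Spectrum.

(* Main.v *)
Require Import Defs.
From mathcomp Require Import all_boot all_order all_algebra.
From mathcomp Require Import all_classical all_reals all_analysis.
From mathcomp Require Import measurable_realfun.
From mathcomp.real_closed Require Import complex mxtens.
From mathcomp Require Import spectral sesquilinear.
From mathcomp Require Import ring lra zify.

Set Implicit Arguments.
Unset Strict Implicit.
Unset Printing Implicit Defensive.

Import Order.TTheory GRing.Theory Num.Theory.
Import numFieldNormedType.Exports.

Local Open Scope classical_set_scope.
Local Open Scope complex_scope.
Local Open Scope ring_scope.
Local Open Scope sesquilinear_scope.

(* Let V simultaneously diagonalize M and K by congruence: V M V^* = 1 and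
   V K V^* = diag(d). The eigenvalues of tau M^-1 K are the tau d_k, and the
   preconditioned matrix is similar to the direct sum over k of the q x q
   matrices (L + tau d_k)^-1 (A_q^-1 + tau d_k), whose eigenvalues tend to 1 as
   tau d_k -> oo. Everything thus reduces to counting the k with tau d_k <= r.

   On the span of the corresponding rows of V, the quadratic form of K is at most
   (r / tau) b |x|^2, where b bounds the form of M uniformly in n. On the grid
   functions vanishing on every l-th line, a subspace of codimension at most
   n (n / l + 1), the form of h^2 K is at least 2 / l^2 |x|^2: this is the Schur
   test for the adjacency matrix of the grid, with the weight j (l - j) on the
   lines between two consecutive zero lines. Since h^2 / tau -> 0 by the balance
   condition, the two subspaces meet trivially for large n, so the count is at
   most n (n / l + 1), for every l. *)

(** * Fourier coefficients of trigonometric polynomials *)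

(** Both halves go through one induction, because additivity of the integral at each step needs
    integrability of the remaining sum. *)
Lemma Rintegral_lincomb d (T : measurableType d) (R : realType)
    (mu : {measure set T -> \bar R}) (D : set T) (mD : measurable D)
    (I : Type) (s : seq I) (c : I -> R) (f : I -> T -> R) :
  (forall i, mu.-integrable D (EFin \o f i)) ->
  mu.-integrable D (EFin \o (fun x => \sum_(i <- s) c i * f i x)) /\
  \int[mu]_(x in D) (\sum_(i <- s) c i * f i x) =
    \sum_(i <- s) c i * \int[mu]_(x in D) f i x.
Proof.
move=> intf; elim: s => [|i s [IHint IHval]].
  rewrite big_nil; split.
    by rewrite (_ : _ \o _ = cst 0%E); [exact: integrable0|
      apply/funext => x /=; rewrite big_nil].
  rewrite (_ : (fun x => _) = cst 0) ?/Rintegral; last first.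
    by apply/funext => x; rewrite big_nil.
  by rewrite integral0_eq.
have intZ : mu.-integrable D (EFin \o (fun x => c i * f i x)).
  exact: (integrableZl mD (c i) (intf i)).
rewrite [X in EFin \o X](_ : _ = fun x => c i * f i x +
    \sum_(i <- s) c i * f i x); last by apply/funext => x; rewrite big_cons.
split; first exact: (integrableD mD intZ IHint).
under eq_Rintegral do rewrite big_cons.
by rewrite RintegralD// IHval RintegralZl// big_cons.
Qed.

Section FourierCoefficients.
Variable R : realType.
Local Notation mu := (@lebesgue_measure R).

Lemma sin_int_mul_pi (p : int) : sin (p%:~R * pi) = 0 :> R.
Proof.
have sin_nat (k : nat) : sin (k%:R * pi) = 0 :> R.
  elim: k => [|k IHk]; first by rewrite mul0r sin0.
  by rewrite -natr1 mulrDl mul1r sinDpi IHk oppr0.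
case: p => k; first exact: sin_nat.
by rewrite NegzE mulrNz mulNr sinN -pmulrn sin_nat oppr0.
Qed.

Lemma continuous_cos_affine (a c : R) : continuous (fun x : R => cos (a * x + c)).
Proof.
move=> x; apply: (@continuous_comp _ _ _ (fun x : R => a * x + c) cos).
  by apply: cvgD; [apply: cvgM; [exact: cvg_cst|exact: cvg_id]|exact: cvg_cst].
exact: continuous_cos.
Qed.

(** The free phase [c] has two uses: it absorbs the other variable in an iterated integral, and it
    turns cosines into sines. For [p != 0] the antiderivative takes equal values at both ends
    because [sin (p * pi)] vanishes. *)
Lemma integral_cos_period (p : int) (c : R) :
  (\int[mu]_(x in `[(- pi)%R, pi]) (cos (p%:~R * x + c))%:E =
   (if p == 0 then 2 * pi * cos c else 0)%:E)%E.
Proof.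
have pi_lt : - pi < pi :> R by rewrite -subr_gt0 opprK addr_gt0 ?pi_gt0.
have [->|p_neq0] := eqVneq p 0.
  under eq_integral do rewrite mul0r add0r.
  rewrite integral_cst//= lebesgue_measure_itv/= lte_fin pi_lt.
  by rewrite -EFinD -EFinM opprK -mulr2n mulr_natl mulrC.
have p_unit : p%:~R != 0 :> R by rewrite intr_eq0.
pose F x : R := p%:~R^-1 * sin (p%:~R * x + c).
have dF (x : R) : is_derive x 1 F (cos (p%:~R * x + c)).
  rewrite /F; apply: is_derive_eq.
  by rewrite /GRing.scale /= addr0 mulr1 [cos _ * _]mulrC mulKf.
have cF : continuous F.
  by move=> x; apply/differentiable_continuous/derivable1_diffP; case: (dF x).
rewrite (@continuous_FTC2 _ _ F)//.
- rewrite -EFinB /F mulrN !sinD cosN sinN sin_int_mul_pi.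
  by rewrite oppr0 !mul0r subrr.
- exact/continuous_subspaceT/continuous_cos_affine.
- split.
  + by move=> x _; case: (dF x).
  + exact/cvg_at_right_filter/cF.
  + exact/cvg_at_left_filter/cF.
- by move=> x _; rewrite derive1E; exact: derive_val.
Qed.

Local Notation box := (`[(- pi)%R, (pi : R)] `*` `[(- pi)%R, (pi : R)]).
Local Notation mu2 := (mu \x mu)%E.

Lemma measurable_box : measurable box.
Proof. exact: measurableX. Qed.

Lemma measurable_cos_phase (k : int * int) (c : R) :
  measurable_fun setT (fun x : R * R => cos (phase k x + c)).
Proof.
apply: (measurableT_comp (f := cos)).
  apply: continuous_measurable_fun; exact: continuous_cos.
by apply: measurable_funD => //; apply: measurable_funD;
  apply: measurable_funM.
Qed.

Lemma integrable_cos_phase (k : int * int) (c : R) :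
  mu2.-integrable box (EFin \o (fun x : R * R => cos (phase k x + c))).
Proof.
apply: measurable_bounded_integrable.
- exact: measurable_box.
- rewrite [X in (X < _)%E]product_measure1E//= !lebesgue_measure_itv/=.
  case: ifPn => _; last by rewrite mule0 ltry. by rewrite -EFinB -EFinM ltry.
- exact: (measurable_funS _ _ (measurable_cos_phase k c)).
- exists 1; split => // M M1 x _ /=.
  exact: (le_trans (cos_max _) (ltW M1)).
Qed.

Lemma Rintegral_cos_phase (k : int * int) (c : R) :
  \int[mu2]_(x in box) cos (phase k x + c) =
  if k == 0 then (2 * pi) ^+ 2 * cos c else 0.
Proof.
rewrite /Rintegral integral_mkcond -integral12_prod_meas1; last first.
  by rewrite -integrable_mkcond; [exact: integrable_cos_phase|exact: measurable_box].
(* For fixed [x], the term [k.1 * x + c] is a constant phase for the integration in the second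
   variable. *)
have inner x : fubini_F mu ((fun x : R * R => (cos (phase k x + c))%:E) \_ box) x =
  (((fun x => (if k.2 == 0 then 2 * pi * cos (k.1%:~R * x + c) else 0)%:E)
    \_ `[(- pi)%R, (pi : R)]) x).
  rewrite /fubini_F [RHS]patchE; case: ifPn => [xD|xD].
    rewrite -integral_cos_period [RHS]integral_mkcond; apply: eq_integral => y _.
    rewrite !patchE in_setX /= xD /=; case: ifP => //= _.
    by rewrite /phase /= [X in cos (X + c)]addrC -addrA.
  rewrite -[RHS](integral0 mu setT); apply: eq_integral => y _.
  by rewrite patchE in_setX /= (negbTE xD).
transitivity (fine (\int[mu]_x ((fun x => (if k.2 == 0 then
    2 * pi * cos (k.1%:~R * x + c) else 0)%:E) \_ `[(- pi)%R, (pi : R)]) x)%E).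
  by congr fine; apply: eq_integral => x _; exact: inner.
rewrite -integral_mkcond; case: k {inner} => k1 k2 /=.
rewrite -pair_eqE /=; have [k20|k2_neq0] := eqVneq k2 0; last first.
  by rewrite andbF integral0_eq.
under eq_integral do rewrite EFinM.
rewrite andbT integralZl//=.
  by rewrite integral_cos_period -EFinM /=; case: ifPn => _;
     rewrite ?mulr0// expr2 !mulrA.
apply: continuous_compact_integrable; first exact: segment_compact.
exact/continuous_subspaceT/continuous_cos_affine.
Qed.

(** The real and the imaginary part of the integrand of a Fourier coefficient both have this shape,
    with different [u] and [v]. *)
Lemma Rintegral_trig_sum (s : seq (int * int)) (l : int * int)
    (u v : int * int -> R) :
  let F x := \sum_(k <- s) (u k * cos (phase (k - l) x) +
                            v k * sin (phase (k - l) x)) in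
  \int[mu2]_(x in box) F x = (2 * pi) ^+ 2 * \sum_(k <- s | k == l) u k.
Proof.
(* Each frequency is listed twice, the flag marking the sine term. A sine is a cosine with phase
   [- pi / 2], so only integrals of cosines remain. *)
move=> F; pose t := [seq (k, false) | k <- s] ++ [seq (k, true) | k <- s].
pose c (i : int * int * bool) := if i.2 then v i.1 else u i.1.
pose f (i : int * int * bool) (x : R * R) : R :=
  cos (phase (i.1 - l) x + (if i.2 then - (pi / 2) else 0)).
have FE : F = fun x => \sum_(i <- t) c i * f i x.
  apply/funext => x; rewrite big_cat !big_map /= -big_split; apply: eq_bigr => k _.
  by rewrite /c /f /= addr0 cosBpihalf.
have [||_ intE] := @Rintegral_lincomb _ _ R mu2 box _ _ t c f.
- exact: measurable_box.
- by move=> i; exact: integrable_cos_phase.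
rewrite FE; apply: etrans; first exact: intE.
rewrite big_cat !big_map /= mulr_sumr [X in _ + X]big1 ?addr0 => [|k _].
  rewrite [RHS]big_mkcond; apply: eq_bigr => k _.
  rewrite Rintegral_cos_phase subr_eq0 cos0 mulr1 /c /=.
  by case: ifP; rewrite ?mulr0// mulrC.
by rewrite Rintegral_cos_phase cosN cos_pihalf mulr0 if_same mulr0.
Qed.

(** By orthogonality of the characters only the frequency [l] survives. The result is a sum because
    [s] may list a frequency several times. *)
Lemma fourier_coef_trig_sum (g : R * R -> R[i]) (s : seq (int * int))
    (a : int * int -> R[i]) (l : int * int) :
  (forall x, g x = \sum_(k <- s) a k * expi (phase k x)) ->
  fourier_coef g l = \sum_(k <- s | k == l) a k.
Proof.
move=> gE.
have phaseB k x : phase k x - phase l x = phase (k - l) x :> R.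
  by rewrite /phase /= !rmorphB /=; ring.
have fE x : g x * expi (- phase l x) =
    \sum_(k <- s) ((complex.Re (a k) * cos (phase (k - l) x) +
                    (- complex.Im (a k)) * sin (phase (k - l) x)) +i*
                   (complex.Im (a k) * cos (phase (k - l) x) +
                    complex.Re (a k) * sin (phase (k - l) x))).
  rewrite gE mulr_suml; apply: eq_bigr => k _; rewrite -phaseB.
  rewrite cosB sinB /expi cosN sinN; case: (a k) => ar ai.
  by apply/eqP; rewrite eq_complex /=; apply/andP; split; apply/eqP; ring.
have ReE (F : seq (int * int)) (w : int * int -> R[i]) (P : pred _) :
  complex.Re (\sum_(k <- F | P k) w k) = \sum_(k <- F | P k) complex.Re (w k).
  exact: raddf_sum.
have ImE (F : seq (int * int)) (w : int * int -> R[i]) (P : pred _) :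
  complex.Im (\sum_(k <- F | P k) w k) = \sum_(k <- F | P k) complex.Im (w k).
  exact: raddf_sum.
rewrite /fourier_coef /cintegral.
under eq_Rintegral do rewrite fE ReE.
under [X in _ +i* X]eq_Rintegral do rewrite fE ImE.
rewrite /= !Rintegral_trig_sum.
have pi2_neq0 : (2 * pi) ^+ 2 != 0 :> R.
  by rewrite expf_neq0// mulf_neq0// gt_eqF ?pi_gt0.
apply/eqP; rewrite eq_complex /= ReE ImE !mul0r subr0 addr0 !mulKf//.
by rewrite !eqxx.
Qed.
End FourierCoefficients.

(** * The Schur test *)

(** Weighted AM-GM, with ratio [phi j / phi i], splits each product of two entries of [u] into
    squares, and the row condition then sums them. The weight may vanish off the support of [u],
    where nothing has to be estimated; this is what permits weights that are zero on whole grid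
    lines. *)
Lemma schur_test_real (R : realFieldType) m (A : 'M[R]_m) (phi : 'I_m -> R)
    (rho : R) (u : 'rV[R]_m) :
  A^T = A -> (forall i, 0 <= phi i) ->
  (forall i, u 0 i != 0 ->
     phi i != 0 /\ \sum_j `|A i j| * phi j <= rho * phi i) ->
  (u *m A *m u^T) 0 0 <= rho * (u *m u^T) 0 0.
Proof.
move=> Asym phi_ge0 Aphi.
pose t i j := `|A i j| * (phi j / phi i) * u 0 i ^+ 2.
have t_ge0 i j : 0 <= t i j.
  by apply: mulr_ge0; rewrite ?sqr_ge0// mulr_ge0// divr_ge0.
have term i j : u 0 i * A i j * u 0 j <= 2^-1 * (t i j + t j i).
  have tC : `|A j i| = `|A i j| by rewrite -{2}Asym mxE.
  have [ui0|ui_neq0] := eqVneq (u 0 i) 0.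
    by rewrite ui0 !mul0r mulr_ge0 ?invr_ge0 ?addr_ge0.
  have [uj0|uj_neq0] := eqVneq (u 0 j) 0.
    by rewrite uj0 mulr0 mulr_ge0 ?invr_ge0 ?addr_ge0.
  rewrite /t tC.
  have [pi_neq0 _] := Aphi i ui_neq0; have [pj_neq0 _] := Aphi j uj_neq0.
  have pij_gt0 : 0 < phi j / phi i.
    by rewrite divr_gt0// lt_def phi_ge0 ?pi_neq0 ?pj_neq0.
  have -> : phi i / phi j = (phi j / phi i)^-1 by rewrite invfM invrK mulrC.
  move: (phi j / phi i) pij_gt0 => p p_gt0.
  have amgm : `|u 0 i| * `|u 0 j| <= 2^-1 * (p * u 0 i ^+ 2 + p^-1 * u 0 j ^+ 2).
    rewrite -subr_ge0.
    have -> : 2^-1 * (p * u 0 i ^+ 2 + p^-1 * u 0 j ^+ 2) - `|u 0 i| * `|u 0 j| =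
       2^-1 * p * (`|u 0 i| - p^-1 * `|u 0 j|) ^+ 2.
      rewrite -[u 0 i ^+ 2]real_normK ?num_real// -[u 0 j ^+ 2]real_normK ?num_real//.
      by field; rewrite gt_eqF.
    by rewrite mulr_ge0 ?sqr_ge0// mulr_ge0 ?invr_ge0// ltW.
  apply: (le_trans (ler_norm _)); rewrite !normrM mulrAC mulrC.
  apply: (le_trans (ler_wpM2l (normr_ge0 _) amgm)).
  by rewrite le_eqVlt; apply/orP; left; apply/eqP; ring.
have -> : (u *m A *m u^T) 0 0 = \sum_i \sum_j u 0 i * A i j * u 0 j.
  rewrite exchange_big mxE; apply: eq_bigr => j _.
  by rewrite mxE mulr_suml; apply: eq_bigr => i _; rewrite mxE.
apply: (@le_trans _ _ (\sum_i \sum_j t i j)).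
  (* Symmetrizing does not change the double sum of [t]. *)
  apply: (@le_trans _ _ (\sum_i \sum_j 2^-1 * (t i j + t j i))).
    by do 2!(apply: ler_sum => ? _).
  rewrite le_eqVlt; apply/orP; left; apply/eqP.
  under eq_bigr do rewrite -mulr_sumr big_split.
  rewrite -mulr_sumr big_split /= [X in _ + X]exchange_big /=.
  by field.
rewrite mxE mulr_sumr; apply: ler_sum => i _; rewrite mxE.
have [ui0|ui_neq0] := eqVneq (u 0 i) 0.
  by rewrite ui0 !mulr0 big1// => j _; rewrite /t ui0 expr2 !mulr0.
have [phi_neq0 le_rho] := Aphi i ui_neq0.
rewrite /t -mulr_suml -expr2 ler_wpM2r ?sqr_ge0//.
under eq_bigr do rewrite mulrA.
by rewrite -mulr_suml ler_pdivrMr// lt_def phi_neq0 phi_ge0.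
Qed.

(** * Quadratic forms on complex vectors *)

Section ComplexForms.
Variable R : realType.
Local Notation C := R[i].
Local Notation toC := (map_mx (real_complex R)).

Definition qform m (A : 'M[C]_m) (x : 'rV[C]_m) : C := (x *m A *m x^t*) 0 0.

(** Writing [x] as [u + i v], the cross terms [u A v] and [v A u] cancel by symmetry of [A]. *)
Lemma qform_real m (A : 'M[R]_m) (x : 'rV[C]_m) :
  A^T = A ->
  let u := map_mx (@complex.Re R) x in let v := map_mx (@complex.Im R) x in
  qform (toC A) x = ((u *m A *m u^T) 0 0 + (v *m A *m v^T) 0 0)%:C.
Proof.
move=> Asym u v.
have xE : x = toC u + 'i%C *: toC v.
  by apply/matrixP => i j; rewrite !mxE {1}[x i j]complexE.
have xsE : x^t* = toC u^T - 'i%C *: toC v^T.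
  apply/matrixP => i j; rewrite !mxE; case: (x j i) => a b /=.
  by apply/eqP; rewrite eq_complex /=; apply/andP; split; apply/eqP; ring.
have vAu : v *m A *m u^T = u *m A *m v^T.
  have -> : v *m A *m u^T = (u *m A *m v^T)^T.
    by rewrite !trmx_mul trmxK Asym mulmxA.
  by apply/matrixP => i j; rewrite !ord1 mxE.
rewrite /qform; have -> : x *m toC A *m x^t* = toC (u *m A *m u^T + v *m A *m v^T).
  rewrite xsE {1}xE !mulmxDl !mulmxBr -!scalemxAl -!scalemxAr -!map_mxM /= vAu.
  rewrite scalerA -expr2 sqr_i scaleN1r opprK map_mxD /= addrA subrK //.
by rewrite [LHS]mxE [in LHS]mxE.
Qed.

Lemma qform1 m (x : 'rV[C]_m) : qform 1%:M x = \sum_i `|x 0 i| ^+ 2.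
Proof.
by rewrite /qform mulmx1 mxE; apply: eq_bigr => i _; rewrite !mxE normCK.
Qed.

Lemma schur_test m (A : 'M[R]_m) (phi : 'I_m -> R) (rho : R) (x : 'rV[C]_m) :
  A^T = A -> (forall i, 0 <= phi i) ->
  (forall i, x 0 i != 0 ->
     phi i != 0 /\ \sum_j `|A i j| * phi j <= rho * phi i) ->
  qform (toC A) x <= rho%:C * qform 1%:M x.
Proof.
move=> Asym phi_ge0 Aphi.
rewrite qform_real// -(map_mx1 (real_complex R)) qform_real ?trmx1// !mulmx1.
rewrite -rmorphM /= lecR mulrDr lerD//;
  apply: (@schur_test_real _ _ _ phi) => // i; rewrite mxE => xi_neq0; apply: Aphi;
  by apply: contra xi_neq0 => /eqP ->.
Qed.
End ComplexForms.

(** * Quadratic forms of two-level Toeplitz matrices *)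

Section ToeplitzBounds.
Variable R : realType.
Local Notation C := R[i].
Local Notation toC := (map_mx (real_complex R)).

Definition gridpos n (i : 'I_(n * n)) : int * int :=
  (((mxtens_unindex i).1 : nat)%:Z, ((mxtens_unindex i).2 : nat)%:Z).

Lemma gridpos_inj n : injective (@gridpos n).
Proof.
move=> i j [divE modE]; apply: ord_inj.
by rewrite (divn_eq i n) (divn_eq j n) divE modE.
Qed.

Lemma toeplitz2E n (g : R * R -> C) s a (i j : 'I_(n * n)) :
  (forall x, g x = \sum_(k <- s) a k * expi (phase k x)) ->
  toeplitz2 n g i j = \sum_(k <- s | k == gridpos i - gridpos j) a k.
Proof.
move=> gE; rewrite mxE -(fourier_coef_trig_sum _ gE) /gridpos.
by case: (mxtens_unindex i) (mxtens_unindex j) => ? ? [].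
Qed.

(** In row [i] a frequency [k] contributes to at most one column, the one at position
    [gridpos i - k]. If that position is off the grid, the right-hand side only gains a nonnegative
    term. *)
Lemma toeplitz_weighted_row_sum n (s : seq (int * int)) (a w : int * int -> R)
    (i : 'I_(n * n)) :
  (forall p, 0 <= w p) ->
  \sum_(j < n * n) `|\sum_(k <- s | k == gridpos i - gridpos j) a k| * w (gridpos j) <=
  \sum_(k <- s) `|a k| * w (gridpos i - k).
Proof.
move=> w_ge0.
apply: (@le_trans _ _ (\sum_(j < n * n) \sum_(k <- s | k == gridpos i - gridpos j)
                          `|a k| * w (gridpos j))).
  apply: ler_sum => j _; rewrite -mulr_suml ler_wpM2r//; exact: ler_norm_sum.
under eq_bigr do rewrite big_mkcond.
rewrite exchange_big; apply: ler_sum => k _ /=; rewrite -big_mkcond /=.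
have eqk j : (k == gridpos i - gridpos j) = (gridpos j == gridpos i - k).
  by rewrite eq_sym subr_eq [RHS]eq_sym subr_eq addrC.
under eq_bigl do rewrite eqk.
have [[j0 /eqP ej0]|none] := pselect (exists j : 'I_(n * n), gridpos j == gridpos i - k).
  rewrite (big_pred1 j0) ?ej0// => j /=; rewrite -ej0.
  by apply/eqP/eqP => [/gridpos_inj|->].
rewrite big_pred0 ?mulr_ge0// => j; apply/negbTE/negP => ej.
by apply: none; exists j.
Qed.

(** The Schur test with constant weight: every row sum is at most the sum of the absolute values of
    the coefficients, whatever [n] is. Real parts of the coefficients suffice since [M] is real. *)
Lemma toeplitz2_form_bounded (g : R * R -> C) : trigpoly g ->
  exists2 b : R, 0 <= b & forall n (M : 'M[R]_(n * n)),
    M^T = M -> toC M = toeplitz2 n g ->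
    forall x, qform (toC M) x <= b%:C * qform 1%:M x.
Proof.
move=> [s [a gE]]; exists (\sum_(k <- s) `|complex.Re (a k)|).
  by rewrite sumr_ge0.
move=> n M Msym ME x; apply: (@schur_test _ _ _ (fun _ => 1)) => // i _; split=> //.
have MijE j : M i j = \sum_(k <- s | k == gridpos i - gridpos j) complex.Re (a k).
  have := congr1 (fun A : 'M[C]_(n * n) => complex.Re (A i j)) ME.
  by rewrite /= mxE (toeplitz2E _ _ gE) /= => ->; exact: raddf_sum.
under eq_bigr do rewrite MijE.
have := @toeplitz_weighted_row_sum n s (@complex.Re R \o a) (fun=> 1) i (fun=> ler01).
by rewrite mulr1; under [X in _ <= X -> _]eq_bigr do rewrite mulr1.
Qed.

(** * The discrete Laplacian and the adjacency matrix of the grid *)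

Definition grid_steps : seq (int * int) := [:: (1, 0); (-1, 0); (0, 1); (0, -1)].

Lemma laplace_symbolE (x : R * R) :
  laplace_symbol x = \sum_(k <- 0 :: grid_steps)
    (if k == 0 then 4 else -1) * expi (phase k x).
Proof.
rewrite /grid_steps !big_cons big_nil /= /expi /phase /=.
rewrite !(mul0r, mul1r, add0r, addr0, mulN1r, sinN, cosN, sin0, cos0).
by apply/eqP; rewrite eq_complex /=; apply/andP; split; apply/eqP; ring.
Qed.

Definition adjacency n : 'M[R]_(n * n) :=
  \matrix_(i, j) \sum_(k <- grid_steps | k == gridpos i - gridpos j) 1.

Lemma laplace_adjacency n (K : 'M[R]_(n * n)) :
  toC K = toeplitz2 n (@laplace_symbol R) -> K = 4%:M - adjacency n.
Proof.
move=> KE; apply/matrixP => i j.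
have := congr1 (fun A : 'M[C]_(n * n) => complex.Re (A i j)) KE.
rewrite /= mxE (toeplitz2E _ _ laplace_symbolE) /= => ->.
rewrite big_cons !mxE; have -> : (0 == gridpos i - gridpos j) = (i == j).
  by rewrite eq_sym subr_eq0; apply/eqP/eqP => [/gridpos_inj|->].
have -> : \sum_(k <- grid_steps | k == gridpos i - gridpos j)
    (if k == 0 then 4 else -1) =
    (- \sum_(k <- grid_steps | k == gridpos i - gridpos j) 1)%:C :> C.
  rewrite rmorphN rmorph_sum /= -sumrN /grid_steps !big_cons !big_nil /=.
  by rewrite rmorph1; do !case: ifP => _.
by case: (i == j); rewrite /= ?mulr1n ?mulr0n ?add0r.
Qed.

Lemma adjacency_sym n : (adjacency n)^T = adjacency n.
Proof.
apply/matrixP => i j; rewrite !mxE.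
rewrite [RHS](perm_big [seq - k | k <- grid_steps])// big_map; apply: eq_bigl => k.
by rewrite eqr_oppLR opprB.
Qed.

Local Open Scope int_scope.

(** The Schur weight between zero lines, extended with period [l] to all integers, since neighbours
    of a boundary point lie off the grid. *)
Definition sawtooth (l : nat) (z : int) : int := (z %% l)%Z * (l%:Z - (z %% l)%Z).

Lemma sawtooth_ge0 l z : (0 < l)%N -> 0 <= sawtooth l z.
Proof.
move=> l_gt0; have l_gt0' : 0 < l%:Z by [].
by rewrite /sawtooth mulr_ge0 ?modz_ge0 ?gt_eqF// subr_ge0 ltW ?ltz_pmod.
Qed.

Lemma sawtooth_le l z : (0 < l)%N -> sawtooth l z <= l%:Z ^+ 2.
Proof.
move=> l_gt0; have l_gt0' : 0 < l%:Z by [].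
have r_ge0 : 0 <= (z %% l)%Z by rewrite modz_ge0 ?gt_eqF.
have := ltz_pmod z l_gt0'; rewrite /sawtooth; nia.
Qed.

(** Inside a period the weight is the parabola [r * (l - r)], whose second difference is -2. *)
Lemma sawtooth_neighbours l z : (0 < l)%N -> (z %% l)%Z != 0 ->
  sawtooth l (z + 1) + sawtooth l (z - 1) = 2 * sawtooth l z - 2.
Proof.
move=> l_gt0; have l_gt0' : 0 < l%:Z by [].
have r_ge0 : 0 <= (z %% l)%Z by rewrite modz_ge0 ?gt_eqF.
have r_lt := ltz_pmod z l_gt0'.
rewrite /sawtooth -[((z + 1) %% l)%Z]modzDml -[((z - 1) %% l)%Z]modzDml.
move: (z %% l)%Z r_ge0 r_lt => r r_ge0 r_lt r_neq0.
have r_gt0 : 0 < r by rewrite lt_def r_neq0.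
rewrite [((r - 1) %% l)%Z]modz_small; last by rewrite ?subr_ge0; lia.
(* When the right neighbour wraps to residue 0, the parabola also vanishes at [l], so the same
   identity holds. *)
have [r1l|r1l] := eqVneq (r + 1) l%:Z.
  by rewrite r1l modzz; nia.
by rewrite [((r + 1) %% l)%Z]modz_small; [ring|lia].
Qed.

Local Close Scope int_scope.

Lemma adjacency_form_le n (x : 'rV[C]_(n * n)) :
  qform (toC (adjacency n)) x <= 4%:C * qform 1%:M x.
Proof.
apply: (@schur_test _ _ _ (fun _ => 1)); [exact: adjacency_sym|by []|].
move=> i _; split=> //; under eq_bigr do rewrite mxE.
have := @toeplitz_weighted_row_sum n grid_steps (fun=> 1) (fun=> 1) i (fun=> ler01).
move/le_trans; apply; rewrite /grid_steps !big_cons big_nil normr1 !mulr1; lra.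
Qed.

(** The weight [w] depends only on the second coordinate: the two steps in the first coordinate
    return [w] each, the other two return [2 w - 2] together. The row sum is thus at most [4 w - 2],
    and [w <= l ^ 2] turns the loss of 2 into the proportional loss [2 w / l ^ 2]. *)
Lemma adjacency_form_le_sparse n l (x : 'rV[C]_(n * n)) : (0 < l)%N ->
  (forall i, (l %| (mxtens_unindex i).2)%N -> x 0 i = 0) ->
  qform (toC (adjacency n)) x <= (4 - 2 / l%:R ^+ 2)%:C * qform 1%:M x.
Proof.
move=> l_gt0 x0; pose w (p : int * int) : R := (sawtooth l p.2)%:~R.
have w_ge0 p : 0 <= w p by rewrite ler0z sawtooth_ge0.
apply: (@schur_test _ _ _ (fun i => w (gridpos i))); [exact: adjacency_sym|by []|].
move=> i xi_neq0; pose z := (gridpos i).2.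
have r_neq0 : (z %% l)%Z != 0.
  apply: contra xi_neq0 => /eqP/dvdz_mod0P r0; apply/eqP/x0.
  by move: r0; rewrite dvdzE.
split.
  rewrite intr_eq0 mulf_neq0// subr_eq0 eq_sym; apply/negP => /eqP r_eq.
  by have := @ltz_pmod z l l_gt0; rewrite r_eq ltxx.
under eq_bigr do rewrite mxE.
have := @toeplitz_weighted_row_sum n grid_steps (fun=> 1) w i w_ge0.
move/le_trans; apply.
have -> : \sum_(k <- grid_steps) `|1| * w (gridpos i - k) =
    4 * w (gridpos i) - 2.
  rewrite /grid_steps !big_cons big_nil normr1 !mul1r addr0 /w /= -/z.
  rewrite subr0 opprK [X in _ + (_ + X)]addrC -intrD sawtooth_neighbours//.
  by move: (sawtooth l z) => W; rewrite rmorphB rmorphM /=; ring.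
have l2_gt0 : 0 < l%:R ^+ 2 :> R by rewrite exprn_gt0// ltr0n.
rewrite mulrBl lerD2l lerN2 mulrAC ler_pdivrMr// ler_pM2l//.
have := sawtooth_le z l_gt0; rewrite -(ler_int R) /w -/z.
by rewrite rmorphXn.
Qed.
End ToeplitzBounds.

(** * Simultaneous diagonalization of a symmetric pencil *)

Section Pencil.
Variable R : realType.
Local Notation C := R[i].
Local Notation toC := (map_mx (real_complex R)).

Lemma char_poly_similar (F : fieldType) m (A B P : 'M[F]_m) :
  P \in unitmx -> A *m P = P *m B -> char_poly A = char_poly B.
Proof.
move=> Punit AP; pose Px := map_mx (@polyC F) P.
have detP_neq0 : \det Px != 0.
  by rewrite det_map_mx polyC_eq0 -unitfE -unitmxE.
apply: (mulIf detP_neq0); rewrite [RHS]mulrC /char_poly -!det_mulmx; congr (\det _).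
rewrite /char_poly_mx mulmxBl mulmxBr -!map_mxM AP; congr (_ - _).
by rewrite scalar_mxC.
Qed.

(** Unique factorization of the characteristic polynomial into linear factors identifies the two
    lists with multiplicities, up to order. *)
Lemma eigenvalues_trig m (A : 'M[R]_m) (T P : 'M[C]_m) :
  P \in unitmx -> toC A *m P = P *m T -> is_trig_mx T ->
  perm_eq (eigenvalues A) [seq T i i | i <- enum 'I_m].
Proof.
move=> Punit AP Ttrig; apply: prod_XsubC_eq; rewrite /eigenvalues.
case: closed_field_poly_normal => z /=.
rewrite (monicP (char_poly_monic _)) scale1r => <-.
by rewrite (char_poly_similar Punit AP) char_poly_trig// big_map big_enum.
Qed.

Lemma unitary_real_diag m (A : 'M[C]_m) : A \is hermsymmx ->
  exists2 P : 'M[C]_m, P \in unitmx &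
    exists d : 'rV[R]_m, P *m P^t* = 1%:M /\ P *m A *m P^t* = diag_mx (toC d).
Proof.
move=> Aherm; have /orthomx_spectralP AE := hermitian_normalmx Aherm.
have Punitary := spectral_unitarymx A; have Punit := spectral_unit A.
exists (spectralmx A) => //; exists (map_mx (@complex.Re R) (spectral_diag A)).
split; first exact/unitarymxP.
rewrite [X in _ *m X *m _]AE -invmx_unitary// !mulmxA mulmxV// mul1mx mulmxK//.
congr diag_mx; apply/matrixP => i j; rewrite !mxE.
have /mxOverP/(_ i j) := hermitian_spectral_diag_real Aherm.
by move/RRe_real.
Qed.

Lemma toC_sym_herm m (A : 'M[R]_m) : A^T = A -> (toC A)^t* = toC A.
Proof.
move=> Asym; rewrite map_trmx Asym -map_mx_comp.
by apply/matrixP => i j; rewrite !mxE; exact: conjc_real.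
Qed.

Lemma spd_qform_gt0 m (A : 'M[R]_m) (x : 'rV[C]_m) :
  spd A -> x != 0 -> 0 < qform (toC A) x.
Proof.
move=> [Asym Apos] x_neq0; rewrite qform_real// ltcR.
have form_gt0 (u : 'rV[R]_m) : u != 0 -> 0 < (u *m A *m u^T) 0 0.
  by move=> u_neq0; have := Apos u^T; rewrite trmxK trmx_eq0; apply.
have form_ge0 (u : 'rV[R]_m) : 0 <= (u *m A *m u^T) 0 0.
  have [->|/form_gt0/ltW//] := eqVneq u 0; by rewrite !mul0mx mxE.
have [u0|u_neq0] := eqVneq (map_mx (@complex.Re R) x) 0; last first.
  by rewrite ltr_wpDr ?form_gt0.
rewrite ltr_wpDl ?form_gt0//; apply: contra x_neq0 => /eqP v0.
apply/eqP/matrixP => i j; rewrite mxE; apply/eqP; rewrite eq_complex.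
move/matrixP/(_ i j): u0 => u0; move/matrixP/(_ i j): v0.
by rewrite !mxE in u0 * => ->; rewrite u0 eqxx.
Qed.

Lemma spd_unit m (A : 'M[R]_m) : spd A -> toC A \in unitmx.
Proof.
move=> Aspd; rewrite unitmxE unitfE; apply/negP => /det0P [x x_neq0 xA0].
by have := spd_qform_gt0 Aspd x_neq0; rewrite /qform xA0 mul0mx mxE ltxx.
Qed.

(** First a congruence [G] takes [M] to the identity; then a unitary [Q] diagonalizes the
    transformed [K] and leaves the identity unchanged. *)
Lemma simultaneous_diag m (M K : 'M[R]_m) : spd M -> K^T = K ->
  exists2 V : 'M[C]_m, V \in unitmx & exists d : 'rV[R]_m,
    V *m toC M *m V^t* = 1%:M /\ V *m toC K *m V^t* = diag_mx (toC d).
Proof.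
move=> Mspd Ksym; have [Msym _] := Mspd.
have Mherm : toC M \is hermsymmx.
  by apply/is_hermitianmxP; rewrite expr0 scale1r toC_sym_herm.
have [P Punit [e [PP PMP]]] := unitary_real_diag Mherm.
(* Each [e 0 i] is the value of the form of [M] at the nonzero row [i] of [P]. *)
have e_gt0 i : 0 < e 0 i.
  have Pi_neq0 : row i P != 0.
    apply/negP => /eqP Pi0; move: (congr1 (fun Z => (row i Z) 0 i) PP).
    by rewrite row_mul Pi0 mul0mx !mxE eqxx => /eqP; rewrite eq_sym oner_eq0.
  have := spd_qform_gt0 Mspd Pi_neq0.
  have -> : qform (toC M) (row i P) = (P *m toC M *m P^t*) i i.
    by rewrite /qform -row_mul !mxE; apply: eq_bigr => j _; rewrite !mxE.
  by rewrite PMP !mxE eqxx mulr1n ltcR.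
pose S : 'M[C]_m := toC (diag_mx (\row_i (Num.sqrt (e 0 i))^-1)).
have Sherm : S^t* = S by rewrite toC_sym_herm ?tr_diag_mx.
have Sunit : S \in unitmx.
  rewrite unitmxE unitfE det_map_mx det_diag fmorph_eq0 prodf_seq_neq0.
  by apply/allP => i _; rewrite mxE invr_eq0 gt_eqF ?sqrtr_gt0.
pose G := S *m P.
have GMG : G *m toC M *m G^t* = 1%:M.
  rewrite /G trmx_mul map_mxM Sherm -!mulmxA [P *m (_ *m _)]mulmxA.
  rewrite [P *m _ *m _]mulmxA PMP.
  rewrite -map_diag_mx -!map_mxM -(map_mx1 (real_complex R)); congr map_mx.
  rewrite mulmx_diag mulmx_diag; apply/matrixP => i j; rewrite !mxE.
  case: eqP => // _; rewrite !mulr1n mulrCA -invfM -expr2 sqr_sqrtr ?ltW//.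
  by rewrite mulfV ?gt_eqF.
have Gunit : G \in unitmx by rewrite unitmx_mul Sunit.
move: G GMG Gunit => G GMG Gunit.
have Bherm : G *m toC K *m G^t* \is hermsymmx.
  apply/is_hermitianmxP; rewrite expr0 scale1r.
  by rewrite !trmx_mul !map_mxM trmxCK toC_sym_herm// mulmxA.
have [Q Qunit [d [QQ QBQ]]] := unitary_real_diag Bherm.
exists (Q *m G); first by rewrite unitmx_mul Qunit.
exists d; rewrite trmx_mul map_mxM; split.
  by rewrite -[RHS]QQ -[X in _ = X *m _](mulmx1 Q) -GMG !mulmxA.
by rewrite -QBQ !mulmxA.
Qed.

Lemma pencil_count_le m p (M K : 'M[R]_m) (V : 'M[C]_m) (d : 'rV[R]_m)
    (Z : 'M[C]_(m, p)) (b delta t : R) :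
  V *m toC M *m V^t* = 1%:M -> V *m toC K *m V^t* = diag_mx (toC d) ->
  0 <= t -> (forall x, qform (toC M) x <= b%:C * qform 1%:M x) ->
  (forall x, x *m Z = 0 -> delta%:C * qform 1%:M x <= qform (toC K) x) ->
  t * b < delta ->
  (#|[pred i | (d 0 i <= t)%R]| <= p)%N.
Proof.
move=> VMV VKV t_ge0 Mle Kge tb_lt.
set J := [pred i | _]; rewrite leqNgt; apply/negP => p_lt.
pose X := rowsub (enum_val : 'I_#|J| -> _) V.
have XAX A : X *m A *m X^t* =
    mxsub (enum_val : 'I_#|J| -> _) enum_val (V *m A *m V^t*).
  apply/matrixP => i j; rewrite !mxE; apply: eq_bigr => k _; rewrite !mxE.
  by congr (_ * _); apply: eq_bigr => l _; rewrite !mxE.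
(* [X *m Z] has more rows than columns, so some nontrivial combination of the selected rows of [V]
   satisfies all [p] linear conditions given by the columns of [Z]. *)
have [w w_neq0 wXZ] : exists2 w : 'rV_#|J|, w != 0 & w *m (X *m Z) = 0.
  have ker_neq0 : kermx (X *m Z) != 0.
    rewrite -mxrank_eq0 mxrank_ker -lt0n subn_gt0.
    exact: leq_ltn_trans (rank_leq_col _) p_lt.
  exists (nz_row (kermx (X *m Z))); first by rewrite nz_row_eq0.
  by apply/sub_kermxP/nz_row_sub.
pose x := w *m X.
have qx A : qform A x = qform (X *m A *m X^t*) w.
  by rewrite /qform /x trmx_mul map_mxM !mulmxA.
have qM : qform (toC M) x = qform 1%:M w.
  rewrite qx XAX VMV; congr qform; apply/matrixP => i j.
  by rewrite !mxE (inj_eq enum_val_inj).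
have qK : qform (toC K) x <= t%:C * qform 1%:M w.
  rewrite qx XAX VKV qform1 mulr_sumr.
  have -> : mxsub (enum_val : 'I_#|J| -> _) enum_val (diag_mx (toC d)) =
      diag_mx (\row_i (d 0 (enum_val i))%:C).
    apply/matrixP => i j; rewrite !mxE (inj_eq enum_val_inj); by case: eqP => // ->.
  rewrite /qform mul_mx_diag mxE; apply: ler_sum => i _; rewrite !mxE mulrAC -normCK mulrC.
  by rewrite ler_wpM2r ?exprn_ge0// lecR; have := enum_valP i; rewrite inE.
have qw_gt0 : 0 < qform 1%:M w.
  rewrite lt_def qform1 sumr_ge0 ?andbT => [|i _]; last by rewrite exprn_ge0.
  apply: contra w_neq0; rewrite psumr_eq0 => [/allP w0|i _]; last by rewrite exprn_ge0.
  apply/eqP/rowP => i; rewrite mxE; apply/eqP.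
  by have := w0 i (mem_index_enum _); rewrite /= expf_eq0 normr_eq0.
have qx_ge0 : 0 <= qform 1%:M x.
  by rewrite qform1 sumr_ge0// => i _; rewrite exprn_ge0.
(* The form of [M] at [x] equals the positive norm of [w], while it would be at most 0 if [x] had
   norm 0. *)
have qx_gt0 : 0 < qform 1%:M x.
  rewrite lt_def qx_ge0 andbT; apply/eqP => qx0.
  by have := Mle x; rewrite qx0 qM => /(lt_le_trans qw_gt0); rewrite mulr0 ltxx.
have : delta%:C * qform 1%:M x <= (t * b)%:C * qform 1%:M x.
  apply: le_trans (Kge x _) _; first by rewrite /x -mulmxA.
  apply: le_trans qK _; rewrite -qM rmorphM -mulrA ler_wpM2l ?ler0c//; exact: Mle.
by rewrite ler_pM2r// lecR leNgt tb_lt.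
Qed.
End Pencil.

(** * Counting the small eigenvalues of the Laplace pencil *)

Section LaplacePencil.
Variable R : realType.
Local Notation C := R[i].
Local Notation toC := (map_mx (real_complex R)).
Variables (n : nat) (h : R) (M K : 'M[R]_(n * n)).
Hypotheses (h_gt0 : 0 < h)
  (K_toep : toC (h ^+ 2 *: K) = toeplitz2 n (@laplace_symbol R)).

Let h2_gt0 : 0 < h ^+ 2. Proof. by rewrite exprn_gt0. Qed.

Lemma stiffnessE : K = (h ^+ 2)^-1 *: (4%:M - adjacency R n).
Proof.
by rewrite -(laplace_adjacency K_toep) scalerA mulVf ?scale1r ?gt_eqF.
Qed.

Lemma stiffness_sym : K^T = K.
Proof. by rewrite stiffnessE linearZ linearB /= tr_scalar_mx adjacency_sym. Qed.

Lemma stiffness_form x :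
  qform (toC K) x =
  ((h ^+ 2)^-1)%:C * (4%:C * qform 1%:M x - qform (toC (adjacency R n)) x).
Proof.
rewrite stiffnessE map_mxZ map_mxB map_scalar_mx /= /qform.
rewrite -[x *m _]scalemxAr -scalemxAl [LHS]mxE; congr (_ * _).
rewrite mulmxBr mulmxBl mxE [X in _ + X = _]mxE; congr (_ - _).
by rewrite -scalemx1 -[x *m (_ *: _)]scalemxAr -scalemxAl mxE.
Qed.

Lemma stiffness_form_ge0 x : 0 <= qform (toC K) x.
Proof.
rewrite stiffness_form mulr_ge0//; first by rewrite ler0c invr_ge0 ltW.
by rewrite subr_ge0 adjacency_form_le.
Qed.

Lemma stiffness_form_ge l (x : 'rV[C]_(n * n)) : (0 < l)%N ->
  (forall i, (l %| (mxtens_unindex i).2)%N -> x 0 i = 0) ->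
  ((h ^+ 2)^-1 * (2 / l%:R ^+ 2))%:C * qform 1%:M x <= qform (toC K) x.
Proof.
move=> l_gt0 x0; rewrite stiffness_form rmorphM -mulrA.
rewrite ler_wpM2l//; first by rewrite ler0c invr_ge0 ltW.
rewrite lerBrDr -lerBrDl -mulrBl -rmorphB.
exact: adjacency_form_le_sparse.
Qed.

Variables (V : 'M[C]_(n * n)) (d : 'rV[R]_(n * n)).
Hypotheses (VMV : V *m toC M *m V^t* = 1%:M)
  (VKV : V *m toC K *m V^t* = diag_mx (toC d)).

Lemma pencil_eigenvalue_ge0 i : 0 <= d 0 i.
Proof.
have := stiffness_form_ge0 (row i V).
have -> : qform (toC K) (row i V) = (V *m toC K *m V^t*) i i.
  by rewrite /qform -row_mul !mxE; apply: eq_bigr => j _; rewrite !mxE.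
by rewrite VKV !mxE eqxx mulr1n ler0c.
Qed.

Lemma laplace_pencil_count_le (tau b r : R) l :
  0 < tau -> 0 <= r -> (0 < l)%N ->
  (forall x, qform (toC M) x <= b%:C * qform 1%:M x) ->
  r * b * l%:R ^+ 2 * h ^+ 2 < 2 * tau ->
  (#|[pred i | (tau * d 0 i <= r)%R]| <= n * (n %/ l).+1)%N.
Proof.
move=> tau_gt0 r_ge0 l_gt0 Mle small.
have l2_gt0 : 0 < l%:R ^+ 2 :> R by rewrite exprn_gt0// ltr0n.
(* The column indexed by the pair (a, k) reads off the coordinate at the grid point (a, k l), and is
   zero when k l is off the grid. Hence [x *m Z = 0] says that [x] vanishes on every [l]-th line; k
   runs from 0 to [n %/ l], which explains the successor. *)
pose Z : 'M[C]_(n * n, n * (n %/ l).+1) := \matrix_(i, c)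
  (((mxtens_unindex i).1 == (mxtens_unindex c).1) &&
   ((mxtens_unindex i).2 == (mxtens_unindex c).2 * l :> nat)%N)%:R.
have -> : #|[pred i | (tau * d 0 i <= r)%R]| = #|[pred i | (d 0 i <= r / tau)%R]|.
  by apply: eq_card => i; rewrite !inE ler_pdivlMr// mulrC.
apply: (pencil_count_le VMV VKV (Z := Z) _ Mle
          (delta := (h ^+ 2)^-1 * (2 / l%:R ^+ 2))).
- by rewrite divr_ge0// ltW.
- move=> x xZ; apply: stiffness_form_ge => // i /dvdnP[k kE].
  have k_lt : (k < (n %/ l).+1)%N.
    by rewrite ltnS leq_divRL// -kE ltnW.
  pose c := mxtens_index ((mxtens_unindex i).1, Ordinal k_lt).
  have := congr1 (fun Y : 'rV__ => Y 0 c) xZ.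
  rewrite /= !mxE (bigD1 i)//= big1 => [|j j_neq]; last first.
    rewrite mxE mxtens_indexK /= -kE.
    case: andP => [[/eqP/(congr1 val) /= e1 /eqP e2]|_]; last by rewrite mulr0.
    case/eqP: j_neq; apply: ord_inj.
    by rewrite (divn_eq j n) (divn_eq i n) e1 e2.
  by rewrite mxE mxtens_indexK /= -kE !eqxx mulr1 addr0.
- have h2_neq0 := gt_eqF h2_gt0; have l2_neq0 := gt_eqF l2_gt0.
  have tau_neq0 := gt_eqF tau_gt0.
  (* Over the common denominator [tau * l ^ 2 * h ^ 2] the required inequality becomes the
     hypothesis [small]. *)
  have -> : r / tau * b = r * b * l%:R ^+ 2 * h ^+ 2 / (tau * l%:R ^+ 2 * h ^+ 2).
    by move: (l%:R ^+ 2) (h ^+ 2) h2_neq0 l2_neq0 => x y ? ?; field; lra.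
  have -> : (h ^+ 2)^-1 * (2 / l%:R ^+ 2) = 2 * tau / (tau * l%:R ^+ 2 * h ^+ 2).
    by move: (l%:R ^+ 2) (h ^+ 2) h2_neq0 l2_neq0 => x y ? ?; field; lra.
  rewrite ltr_pM2r// invr_gt0.
  by apply: mulr_gt0; first apply: mulr_gt0.
Qed.
End LaplacePencil.

(** * Spectrum of the preconditioned matrix *)

Section FiberMatrix.
Variables (F : fieldType) (q m : nat).
Implicit Types B : 'I_m -> 'M[F]_q.

(* The direct sum of the B k, with its rows and columns in the order of
   [A *t M] rather than block by block. *)
Definition fiber_mx B : 'M[F]_(q * m) := \matrix_(i, j)
  if (mxtens_unindex i).2 == (mxtens_unindex j).2 then
    B (mxtens_unindex i).2 (mxtens_unindex i).1 (mxtens_unindex j).1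
  else 0.

Lemma big_mxtens_index (T : Type) (idx : T) (op : Monoid.com_law idx)
    (f : 'I_(q * m) -> T) :
  \big[op/idx]_i f i = \big[op/idx]_k \big[op/idx]_a f (mxtens_index (a, k)).
Proof.
rewrite exchange_big pair_bigA /= (reindex (@mxtens_index q m)) /=.
  by apply: eq_bigr => -[].
by exists (@mxtens_unindex q m) => ? _; rewrite ?mxtens_indexK ?mxtens_unindexK.
Qed.

Lemma eq_fiber_mx B B' : B =1 B' -> fiber_mx B = fiber_mx B'.
Proof. by move=> eqB; apply/matrixP => i j; rewrite !mxE eqB. Qed.

Lemma fiber_mxM B B' : fiber_mx B *m fiber_mx B' = fiber_mx (fun k => B k *m B' k).
Proof.
apply/matrixP => i j; case: (mxtens_indexP i) => a k; case: (mxtens_indexP j) => b l.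
rewrite !mxE big_mxtens_index !mxtens_indexK /= (bigD1 k) //= [X in _ + X]big1 ?addr0.
  case: eqP => [<-|kl]; last first.
    rewrite big1// => c _; rewrite !mxE !mxtens_indexK /=.
    by case: (k =P l) => // _; rewrite mulr0.
  by apply: eq_bigr => c _; rewrite !mxE !mxtens_indexK /= !eqxx.
move=> k' k'k; rewrite big1// => c _; rewrite !mxE !mxtens_indexK /=.
by rewrite eq_sym (negbTE k'k) mul0r.
Qed.

Lemma fiber_mx1 : fiber_mx (fun=> 1%:M) = 1%:M.
Proof.
apply/matrixP => i j; rewrite !mxE -(can_eq (@mxtens_unindexK q m)).
case: (mxtens_unindex i) (mxtens_unindex j) => a k [b l] /=.
by rewrite xpair_eqE andbC; case: (k == l).
Qed.

Lemma fiber_mx_unit B : (forall k, B k \in unitmx) ->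
  fiber_mx B \in unitmx /\ invmx (fiber_mx B) = fiber_mx (fun k => invmx (B k)).
Proof.
move=> Bunit; have BV : fiber_mx B *m fiber_mx (fun k => invmx (B k)) = 1%:M.
  by rewrite fiber_mxM -fiber_mx1; apply: eq_fiber_mx => k; rewrite mulmxV.
have [Yunit _] := mulmx1_unit BV; split=> //.
by rewrite -[RHS]mul1mx -(mulVmx Yunit) -mulmxA BV mulmx1.
Qed.

(** Positions sharing their second index are ordered by their first index, so each block keeps its
    order inside the large matrix. *)
Lemma fiber_mx_trig B : (forall k, is_trig_mx (B k)) -> is_trig_mx (fiber_mx B).
Proof.
move=> Btrig; apply/is_trig_mxP => i j lt_ij; rewrite mxE.
case: eqP => // /(congr1 val) /= eq_mod.
have /is_trig_mxP -> // := Btrig (mxtens_unindex i).2.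
rewrite ltnNge; apply/negP => /= le_div; move: lt_ij.
by rewrite ltnNge (divn_eq j m) (divn_eq i m) eq_mod leq_add2r leq_mul2r le_div orbT.
Qed.

Lemma tens_fiber_mx (A : 'M[F]_q) (s : 'rV[F]_m) :
  A *t 1%:M + 1%:M *t diag_mx s = fiber_mx (fun k => A + (s 0 k)%:M).
Proof.
apply/matrixP => i j; rewrite !mxE.
case: (mxtens_unindex i) (mxtens_unindex j) => a k [b l] /=.
case: (k == l); rewrite ?mulr0 ?mulr0n ?mulr1n ?mulr1 ?addr0//.
by case: (a == b); rewrite ?mul1r ?mul0r.
Qed.
End FiberMatrix.

(** A left null vector [v] gives [w (v Y + s v) = v X]; comparing both sides at an entry of [v] of
    largest modulus yields the bound. With [X = A - L], [Y = L] and [w] an eigenvalue minus 1, it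
    forces [w] to be small when [s] is large. *)
Lemma mx_pencil_singular_bound (F : numFieldType) q (X Y : 'M[F]_q) (s w : F) :
  \det (w *: (Y + s%:M) - X) = 0 ->
  `|w| * (`|s| - \sum_i \sum_j `|Y i j|) <= \sum_i \sum_j `|X i j|.
Proof.
move=> /eqP/det0P [v v_neq0 vE].
have [i0 vi0] : exists i0, v 0 i0 != 0.
  apply/existsP; apply: contraNT v_neq0 => /existsPn v0.
  by apply/eqP/rowP => i; rewrite mxE; apply/eqP/negPn/v0.
have [j jmax] : exists j, forall i, `|v 0 i| <= `|v 0 j|.
  exists [arg max_(i > i0 | true) `|v 0 i|]%O.
  by case: real_arg_maxP => [//|i _|i _ imax l]; [exact: normr_real|exact: imax].
have vj_gt0 : 0 < `|v 0 j| by rewrite (lt_le_trans _ (jmax i0))// normr_gt0.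
have rowsum (Z : 'M[F]_q) : `|(v *m Z) 0 j| <= `|v 0 j| * \sum_i \sum_l `|Z i l|.
  rewrite mxE mulr_sumr; apply: le_trans (ler_norm_sum _ _ _) _.
  apply: ler_sum => i _; rewrite normrM ler_pM//.
  by rewrite (bigD1 j)//= lerDl sumr_ge0.
have vX : w *: (v *m Y + s *: v) = v *m X.
  apply/eqP; rewrite -subr_eq0 -vE mulmxBr -scalemxAr mulmxDr mul_mx_scalar.
  by apply/eqP.
rewrite -(ler_pM2l vj_gt0); apply: le_trans (rowsum X).
rewrite -vX mxE normrM mulrCA ler_wpM2l//.
rewrite mulrBr lerBlDr; apply: le_trans (lerD (lexx _) (rowsum Y)).
rewrite -normrM mulrC; have -> : s * v 0 j = (v *m Y + s *: v) 0 j - (v *m Y) 0 j.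
  by rewrite !mxE addrC addKr.
exact: ler_normB.
Qed.

Lemma tens1_unit (F : fieldType) q m (Y : 'M[F]_m) :
  Y \in unitmx -> (1%:M : 'M[F]_q) *t Y \in unitmx.
Proof.
move=> Yunit; have := tensmx_mul (1%:M : 'M[F]_q) Y 1%:M (invmx Y).
rewrite mulmx1 mulmxV//; have -> : 1%:M *t 1%:M = 1%:M :> 'M[F]_(q * m).
  apply/matrixP => i j; rewrite !mxE -[in RHS](can_eq (@mxtens_unindexK q m)).
  by rewrite -natrM mulnb; case: (mxtens_unindex i) (mxtens_unindex j) => ? ? [].
by move/mulmx1_unit => [].
Qed.

(** * Eigenvalues of the preconditioned matrix far from 1 *)

Section PreconditionedSpectrum.
Variable R : realType.
Local Notation C := R[i].
Local Notation toC := (map_mx (real_complex R)).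

Definition entry_sum q (A : 'M[R]_q) : R := \sum_i \sum_j `|A i j|.

Lemma entry_sum_ge0 q (A : 'M[R]_q) : 0 <= entry_sum A.
Proof. by apply: sumr_ge0 => i _; apply: sumr_ge0. Qed.

Lemma entry_sum_toC q (A : 'M[R]_q) :
  \sum_i \sum_j `|toC A i j| = (entry_sum A)%:C.
Proof.
rewrite rmorph_sum; apply: eq_bigr => i _; rewrite rmorph_sum.
by apply: eq_bigr => j _; rewrite mxE normc_def /= expr0n addr0 sqrtr_sqr.
Qed.

Variables (q m : nat) (A L : 'M[R]_q) (M K : 'M[R]_m) (tau : R).
Variables (V : 'M[C]_m) (d : 'rV[R]_m).
Hypotheses (q_gt0 : (0 < q)%N) (L_trig : is_trig_mx L)
  (L_diag : forall i, 0 < L i i) (tau_gt0 : 0 < tau) (V_unit : V \in unitmx)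
  (VMV : V *m toC M *m V^t* = 1%:M)
  (VKV : V *m toC K *m V^t* = diag_mx (toC d)) (d_ge0 : forall i, 0 <= d 0 i).

Let sigma k : C := (tau * d 0 k)%:C.
Let fiber (B : 'M[R]_q) k : 'M[C]_q := toC B + (sigma k)%:M.

(** The diagonalizing congruence acts on the space factor only, hence is the same for every [B]: it
    brings both stage matrices to fiber form and cancels in their quotient. *)
Lemma stage_mx_fiber (B : 'M[R]_q) :
  (1%:M *t V) *m toC (stage_mx B M K tau) *m (1%:M *t V^t*) = fiber_mx (fiber B).
Proof.
have -> : fiber_mx (fiber B) =
    toC B *t 1%:M + 1%:M *t diag_mx (\row_k sigma k).
  by rewrite tens_fiber_mx; apply: eq_fiber_mx => k; rewrite /fiber mxE.
rewrite /stage_mx map_mxD map_mxZ !map_mxT map_mx1 /= mulmxDr mulmxDl.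
rewrite -scalemxAr -scalemxAl !tensmx_mul !mulmx1 !mul1mx VMV VKV; congr (_ + _).
apply/matrixP => i j; rewrite !mxE; rewrite /sigma rmorphM /=.
by rewrite mulrCA mulrnAr.
Qed.

Lemma fiberL_unit k : fiber L k \in unitmx.
Proof.
have -> : fiber L k = toC (L + (tau * d 0 k)%:M) by rewrite map_mxD map_scalar_mx.
rewrite map_unitmx unitmxE unitfE det_trig.
  apply/prodf_neq0 => i _; rewrite !mxE eqxx mulr1n gt_eqF//.
  by rewrite ltr_pwDl// mulr_ge0// ltW.
apply/is_trig_mxP => i j lt_ij; rewrite !mxE (is_trig_mxP L_trig)//.
by rewrite -val_eqE /= ltn_eqF// mulr0n addr0.
Qed.

Lemma preconditioned_count (eps : R) : 0 < eps ->
  (count (fun z => (eps%:C <= `|z - 1|)%R)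
    (eigenvalues (invmx (stage_mx L M K tau) *m stage_mx A M K tau)) <=
   q * #|[pred k | (tau * d 0 k <= entry_sum (A - L) / eps + entry_sum L)%R]|)%N.
Proof.
(* Triangularizing each Bm k separately makes [fiber_mx] triangular, so the
   eigenvalues, with multiplicity, are the diagonal entries of the T k. *)
move=> eps_gt0; pose Bm k := invmx (fiber L k) *m fiber A k.
have /fin_all_exists [Q Qp] k : exists Q : 'M[C]_q,
    Q \in unitmx /\ is_trig_mx (Q *m Bm k *m invmx Q).
  have [Q Qunitary Qtrig] := Schur (Bm k) q_gt0.
  have Qunit := unitarymx_unit Qunitary.
  by exists Q; rewrite -conjumx.
pose T k := Q k *m Bm k *m invmx (Q k).
have Qunit k : Q k \in unitmx by case: (Qp k).
have Ttrig k : is_trig_mx (T k) by case: (Qp k).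
have TE k : T k = Q k *m Bm k *m invmx (Q k) by [].
clearbody T.
pose W : 'M[C]_(q * m) := 1%:M *t V^t*.
have VtV : V^t* \in unitmx by rewrite map_unitmx unitmx_tr.
have Wunit : W \in unitmx by exact: tens1_unit.
pose W' : 'M[C]_(q * m) := 1%:M *t V.
have W'unit : W' \in unitmx by exact: tens1_unit.
have [FLunit FLinv] := fiber_mx_unit fiberL_unit.
pose P := toC (stage_mx L M K tau).
have Punit : P \in unitmx.
  move: FLunit; rewrite -stage_mx_fiber -/P !unitmx_mul; by case/andP => /andP[].
have PAW : toC (invmx (stage_mx L M K tau) *m stage_mx A M K tau) *m W =
    W *m fiber_mx Bm.
  rewrite -fiber_mxM -FLinv map_mxM map_invmx -/P -mulmxA.
  apply: (canLR (mulKmx Punit)); apply: (can_inj (mulKmx W'unit)).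
  rewrite !mulmxA stage_mx_fiber -/P.
  by rewrite (stage_mx_fiber L) mulmxV// mul1mx.
have [QVunit QVinv] := fiber_mx_unit Qunit.
pose U := W *m fiber_mx (fun k => invmx (Q k)).
have Uunit : U \in unitmx by rewrite unitmx_mul Wunit -QVinv unitmx_inv.
have PAU : toC (invmx (stage_mx L M K tau) *m stage_mx A M K tau) *m U =
    U *m fiber_mx T.
  rewrite /U mulmxA PAW -!mulmxA !fiber_mxM; congr (_ *m _); apply: eq_fiber_mx => k.
  by rewrite TE !mulmxA mulVmx// mul1mx.
(* [Bm k - 1] equals the inverse of [fiber L k] times [A - L], so an eigenvalue minus 1 makes the
   pencil of [A - L] and [fiber L k] singular. *)
have Teig k a : `|T k a a - 1| * ((tau * d 0 k)%:C - (entry_sum L)%:C) <=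
    (entry_sum (A - L))%:C.
  have -> : (tau * d 0 k)%:C = `|sigma k|.
    by rewrite ger0_norm// ler0c mulr_ge0// ltW.
  rewrite -!entry_sum_toC; apply: mx_pencil_singular_bound.
  have -> : (T k a a - 1) *: (toC L + (sigma k)%:M) - toC (A - L) =
     fiber L k *m ((T k a a)%:M - Bm k).
    rewrite mulmxBr mul_mx_scalar scalerBl scale1r map_mxB.
    by rewrite -addrA -opprD [X in - X]addrC subrKA /Bm mulKVmx ?fiberL_unit.
  rewrite det_mulmx; suff -> : \det ((T k a a)%:M - Bm k) = 0 by rewrite mulr0.
  have detQ_neq0 : \det (Q k) != 0 by rewrite -unitfE -unitmxE.
  apply: (mulfI detQ_neq0); rewrite mulr0 -det_mulmx.
  have -> : Q k *m ((T k a a)%:M - Bm k) = ((T k a a)%:M - T k) *m Q k.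
    by rewrite mulmxBr mulmxBl scalar_mxC TE mulmxKV.
  rewrite det_mulmx det_trig.
    by rewrite (bigD1 a)//= !mxE eqxx mulr1n subrr !mul0r.
  apply/is_trig_mxP => i j lt_ij; rewrite !mxE (is_trig_mxP (Ttrig k) i j lt_ij).
  by rewrite -val_eqE /= ltn_eqF// subr0.
have Tfar k a : eps%:C <= `|T k a a - 1| ->
    tau * d 0 k <= entry_sum (A - L) / eps + entry_sum L.
  move=> far; rewrite -lerBlDr ler_pdivlMr//.
  have [le_L|lt_L] := leP (tau * d 0 k) (entry_sum L).
    apply: le_trans (entry_sum_ge0 _).
    by rewrite mulr_le0_ge0 ?subr_le0// ltW.
  rewrite -lecR rmorphM rmorphB mulrC; apply: le_trans (Teig k a).
  by rewrite ler_wpM2r// -rmorphB ler0c subr_ge0 ltW.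
(* Each [k] below the threshold accounts for at most [q] far eigenvalues, and every other [k] for
   none. *)
have := eigenvalues_trig Uunit PAU (fiber_mx_trig Ttrig).
move/permP => ->; rewrite count_map -sum1_count big_enum_cond /= big_mkcond.
rewrite big_mxtens_index -sum1_card big_distrr /= [leqRHS]big_mkcond /=.
apply: leq_sum => k _; rewrite muln1.
have [_|not_far] := boolP (k \in _).
  apply: leq_trans (_ : \sum_(a < q) 1 <= _)%N; last by rewrite sum1_card card_ord.
  by apply: leq_sum => a _; case: ifP.
rewrite big1// => a _; case: ifP => // far; case/negP: not_far.
rewrite inE; apply: (Tfar k a); move: far.
by rewrite mxE mxtens_indexK /= eqxx.
Qed.
End PreconditionedSpectrum.

(** * Asymptotic distribution *)

Section Asymptotics.
Variable R : realType.
Local Notation C := R[i].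
Local Notation toC := (map_mx (real_complex R)).

Lemma size_eigenvalues m (A : 'M[R]_m) : size (eigenvalues A) = m.
Proof.
rewrite /eigenvalues; case: closed_field_poly_normal => z /=.
rewrite (monicP (char_poly_monic _)) scale1r => /(congr1 (size \o polyseq)) /=.
by rewrite size_char_poly size_prod_XsubC => -[].
Qed.

(** Compare p-th powers: [(A h^2)^p] is [A^p h^(2p-2)] times [h^2], and for [h < 1] the first factor
    is at most [A^p h], which drops below [c0] as [h] tends to 0. *)
Lemma balance_small (p : nat) (h tau : nat -> R) (c0 A : R) :
  (2 <= p)%N -> 0 < c0 -> 0 <= A -> (forall n, 0 < h n) -> (forall n, 0 < tau n) ->
  h n @[n --> \oo] --> (0 : R) ->
  (forall n, c0 * h n ^+ 2 <= tau n ^+ p) ->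
  \forall n \near \oo, A * h n ^+ 2 < 2 * tau n.
Proof.
move=> p_ge2 c0_gt0 A_ge0 h_gt0 tau_gt0 h_cvg0 bal.
have e_gt0 : 0 < Num.min 1 (c0 / (A ^+ p + 1)).
  by rewrite lt_min ltr01 divr_gt0// ltr_wpDl// exprn_ge0.
near=> n.
have : `|0 - h n| < Num.min 1 (c0 / (A ^+ p + 1)).
  by near: n; move/cvgrPdist_lt : h_cvg0; apply.
rewrite sub0r normrN gtr0_norm// lt_min => /andP[h_lt1 h_lt].
have hn_gt0 := h_gt0 n; have taun_gt0 := tau_gt0 n.
rewrite -(@ltr_pXn2r _ p) ?nnegrE; last 3 first.
- exact: ltn_trans p_ge2.
- by rewrite mulr_ge0// exprn_ge0// ltW.
- by rewrite mulr_ge0// ltW.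
apply: (@lt_le_trans _ _ (c0 * h n ^+ 2)); last first.
  apply: (le_trans (bal n)); rewrite exprMn ler_peMl//.
    by rewrite exprn_ge0// ltW.
  by rewrite exprn_ege1// ler1n.
rewrite exprMn; have -> : (h n ^+ 2) ^+ p = (h n ^+ 2) ^+ p.-1 * h n ^+ 2.
  by rewrite -exprSr prednK// ltnW.
rewrite mulrA ltr_pM2r ?exprn_gt0//.
apply: (@le_lt_trans _ _ (A ^+ p * h n)).
  rewrite ler_wpM2l ?exprn_ge0// -exprM.
  rewrite -[leRHS]expr1 ler_wiXn2l// ?ltW//.
  by rewrite muln_gt0 -subn1 subn_gt0.
have Ap_ge0 : 0 <= A ^+ p by rewrite exprn_ge0.
have Ap1_gt0 : 0 < A ^+ p + 1 by rewrite ltr_wpDl.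
move: h_lt; rewrite ltr_pdivlMr// => h_lt; apply: le_lt_trans h_lt.
by rewrite mulrC ler_pM2l// lerDl.
Unshelve. all: by end_near.
Qed.

Lemma sparse_count_density (q : nat) (u : nat -> nat) : (0 < q)%N ->
  (forall l, (0 < l)%N -> \forall n \near \oo, (u n <= q * (n * (n %/ l).+1))%N) ->
  (u n)%:R / (q * (n * n))%:R @[n --> \oo] --> (0 : R).
Proof.
move=> q_gt0 u_le; apply/cvgrPdist_le => e e_gt0.
(* For [n >= l] one has [n %/ l + 1 <= 2 n / l], so the density is at most [2 / l], which is below
   [e]. *)
pose l := (Num.truncn (2 / e)).+1.
have l_gt0 : (0 < l)%N by [].
have l_gt : 2 / e < l%:R :> R by rewrite truncnS_gt.
near=> n.
have n_ge : (l <= n)%N by near: n; exact: nbhs_infty_ge.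
have n_gt0 : (0 < n)%N by exact: leq_trans n_ge.
rewrite sub0r normrN ger0_norm ?divr_ge0//.
have qnn_gt0 : 0 < (q * (n * n))%:R :> R by rewrite ltr0n !muln_gt0 q_gt0 n_gt0.
rewrite ler_pdivrMr//.
apply: (@le_trans _ _ (q * (n * (n %/ l).+1))%:R).
  by rewrite ler_nat; near: n; exact: u_le.
rewrite !natrM [leRHS]mulrCA ler_pM2l ?ltr0n// [leRHS]mulrCA ler_pM2l ?ltr0n//.
have : ((n %/ l).+1%:R * l%:R <= 2 * n%:R :> R).
  rewrite -!natrM ler_nat mulSn mul2n -addnn leq_add//.
  by rewrite leq_divM.
move: l_gt; rewrite ltr_pdivrMr// => l_gt nl_le.
have l_gt0' : 0 < l%:R :> R by rewrite ltr0n.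
rewrite -(ler_pM2r l_gt0'); apply: (le_trans nl_le).
have n_gt0' : 0 < n%:R :> R by rewrite ltr0n.
have := mulr_gt0 n_gt0' (_ : 0 < l%:R * e - 2); rewrite subr_gt0 => /(_ l_gt); lra.
Unshelve. all: by end_near.
Qed.

Lemma compact_support_bounded (F : C^o -> C^o) :
  continuous F -> compact (closure [set z | F z != 0]) ->
  exists2 B : R, 0 <= B & forall z, `|F z : C| <= B%:C.
Proof.
move=> Fcont Fcpt; pose g (z : C^o) : R^o := complex.Re `|F z : C|.
have gE z : (g z)%:C = `|F z : C| by rewrite /g normc_def.
have gcont : continuous g.
  move=> z; apply: (iffRL (@cvgrPdist_lt _ R^o _ (nbhs z) _ g (g z))) => e e_gt0.
  have Fnear : \forall w \near z, `|F z - F w : C| < e%:C.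
    by apply: (iffLR (@cvgrPdist_lt _ C^o _ (nbhs z) _ F (F z)) (Fcont z)); rewrite ltcR.
  near=> w; have near_zw : `|F z - F w : C| < e%:C by near: w.
  rewrite -ltcR; apply: le_lt_trans near_zw.
  apply: le_trans (ler_dist_dist _ _).
  by rewrite -!gE -rmorphB /= [X in _ <= X]normc_def /= expr0n addr0 sqrtr_sqr.
have /compact_bounded [B [_ Bbound]] :=
  continuous_compact (continuous_subspaceT gcont) Fcpt.
exists (`|B| + 1); first by rewrite addr_ge0.
move=> z; have [Fz0|Fz_neq0] := eqVneq (F z) 0.
  by rewrite Fz0 normr0 ler0c addr_ge0.
rewrite -gE lecR; apply: le_trans (ler_norm _) _.
apply: (Bbound (`|B| + 1)); first by rewrite (le_lt_trans (ler_norm _)) ?ltrDl.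
by exists z => //; exact: subset_closure.
Unshelve. all: by end_near.
Qed.

(** Eigenvalues near 1 change [F] by at most half the tolerance, by continuity. The others change it
    by at most twice the bound of [F], and their proportion tends to 0. *)
Lemma clustered_spectral_dist (d : nat -> nat) (X : forall n, 'M[R]_(d n)) :
  (\forall n \near \oo, (0 < d n)%N) ->
  clustered_at_one X -> spectral_dist_one X.
Proof.
move=> d_gt0 Xcl F Fcont Fcpt.
have [B B_ge0 FB] := compact_support_bounded Fcont Fcpt.
apply/cvgrPdist_le => e e_gt0.
(* Tolerances in the complex plane are positive elements of [R[i]], hence real. *)
have [e' e'_gt0 eE] : exists2 e' : R, 0 < e' & e = e'%:C.
  exists (complex.Re e); last by rewrite RRe_real// gtr0_real.
  by rewrite -ltcR RRe_real// gtr0_real.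
have e2_gt0 : 0 < e' / 2 by rewrite divr_gt0.
have : \forall z \near (1 : C^o), `|F 1 - F z| <= (e' / 2)%:C.
  by move/cvgrPdist_le: (Fcont 1); apply; rewrite ltcR.
move/nbhs_ballP => [del del_gt0 Fnear].
have [del' del'_gt0 delE] : exists2 del' : R, 0 < del' & del = del'%:C.
  exists (complex.Re del); last by rewrite RRe_real// gtr0_real.
  by rewrite -ltcR RRe_real// gtr0_real.
(* With this proportion of far eigenvalues their contribution [2 * B * e' / (4 * B + 1)] stays below
   [e' / 2]; the added 1 covers [B = 0]. *)
have e3_gt0 : 0 < e' / (4 * B + 1) by rewrite divr_gt0// ltr_wpDl// mulr_ge0.
near=> n.
have dn_gt0 : (0 < d n)%N by near: n.
have : `|0 - (count (fun z => (del'%:C <= `|z - 1|)%R)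
                (eigenvalues (X n)))%:R / (d n)%:R|
   <= e' / (4 * B + 1).
  by near: n; move/cvgrPdist_le: (Xcl del' del'_gt0); apply.
rewrite sub0r normrN ger0_norm ?divr_ge0//.
set cnt := count _ _; set s := eigenvalues _ => cnt_le.
have d_neq0 : (d n)%:R != 0 :> C by rewrite pnatr_eq0 -lt0n.
have -> : F 1 = (\sum_(z <- s) F 1) / (d n)%:R :> C.
  rewrite big_const_seq count_predT size_eigenvalues iter_addr_0.
  by rewrite -[X in _ = X / _]mulr_natr mulfK.
rewrite -mulrBl -sumrB; pose far (z : C) := del'%:C <= `|z - 1|.
have termwise (z : C) : `|F 1 - F z : C| <= (e' / 2 + 2 * B *+ far z)%:C.
  rewrite /far; case: (boolP (del'%:C <= _)) => [_|].
    apply: le_trans (ler_normB (F 1 : C) (F z : C)) _.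
    apply: le_trans (lerD (FB 1) (FB z)) _.
    by rewrite -rmorphD lecR mulr1n; lra.
  rewrite -real_ltNge; [move=> near_z|exact: normr_real|by rewrite ger0_real// ler0c ltW].
  rewrite mulr0n addr0; apply: Fnear.
  by rewrite -ball_normE /= distrC delE.
have sum_le : `|\sum_(z <- s) (F 1 - F z) : C| <=
    ((d n)%:R * (e' / 2) + 2 * B * cnt%:R)%:C.
  apply: le_trans (ler_norm_sum _ _ _) _.
  apply: (@le_trans _ _ (\sum_(z <- s) (e' / 2 + 2 * B *+ far z)%:C)).
    by apply: ler_sum => z _; exact: termwise.
  rewrite -rmorph_sum lecR big_split /= big_const_seq count_predT size_eigenvalues.
  rewrite iter_addr_0 -[X in X + _]mulr_natl lerD2l.
  under eq_bigr do rewrite -mulr_natr; rewrite -mulr_sumr -natr_sum.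
  have -> : cnt = (\sum_(z <- s) far z)%N; last by [].
  rewrite /cnt -sum1_count big_mkcond; apply: eq_bigr => z _.
  by rewrite /far; case: ifP.
have dn_gt0' : 0 < (d n)%:R :> R by rewrite ltr0n.
rewrite normrM normfV normr_nat ler_pdivrMr ?ltr0n// eE.
apply: le_trans sum_le _; rewrite -(rmorph_nat (real_complex R)) -rmorphM lecR.
move: cnt_le; rewrite ler_pdivrMr// => cnt_le.
have : 2 * B * cnt%:R <= 2 * B * (e' / (4 * B + 1) * (d n)%:R).
  by rewrite ler_wpM2l// mulr_ge0.
have : 2 * B * (e' / (4 * B + 1)) <= e' / 2.
  rewrite mulrA ler_pdivrMr ?ltr_wpDl ?mulr_ge0//.
  nra.
nra.
Unshelve. all: by end_near.
Qed.
End Asymptotics.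

(** Cancelling [V] in the two congruences gives [K V^* = M V^* D], so the columns of [V^*] are
    eigenvectors of [invmx M *m K]. *)
Lemma pencil_eigenvalues (R : realType) m (M K : 'M[R]_m) (tau : R)
    (V : 'M[R[i]]_m) (d : 'rV[R]_m) :
  spd M -> V \in unitmx ->
  V *m map_mx (real_complex R) M *m V^t* = 1%:M ->
  V *m map_mx (real_complex R) K *m V^t* = diag_mx (map_mx (real_complex R) d) ->
  perm_eq (eigenvalues (tau *: (invmx M *m K)))
          [seq (tau * d 0 i)%:C | i <- enum 'I_m].
Proof.
move=> Mspd Vunit VMV VKV.
pose D : 'M[R[i]]_m := map_mx (real_complex R) (diag_mx (tau *: d)).
have VtV : V^t* \in unitmx by rewrite map_unitmx unitmx_tr.
have -> : [seq (tau * d 0 i)%:C | i <- enum 'I_m] = [seq D i i | i <- enum 'I_m].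
  by apply: eq_map => i; rewrite !mxE eqxx mulr1n.
apply: (eigenvalues_trig VtV); last first.
  by rewrite /D map_diag_mx diag_mx_is_trig.
rewrite map_mxZ map_mxM map_invmx -scalemxAl -mulmxA.
have Munit := spd_unit Mspd.
have -> : map_mx (real_complex R) K *m V^t* =
    map_mx (real_complex R) M *m V^t* *m diag_mx (map_mx (real_complex R) d).
  apply: (can_inj (mulKmx Vunit)).
  by rewrite !mulmxA VMV mul1mx VKV.
rewrite -!mulmxA mulKmx// /D map_diag_mx map_mxZ linearZ /= -scalemxAr //.
Qed.

Theorem theorem5 (R : realType) (q : nat) (hq : (2 <= q)%N)
  (c : 'I_q -> R) (hc : radau_nodes c)
  (L U : 'M[R]_q) (hLU : crout_LU (invmx (collocation_mx c)) L U)
  (h tau : nat -> R)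
  (h_gt0 : forall n, 0 < h n) (h_cvg0 : h n @[n --> \oo] --> (0 : R))
  (tau_gt0 : forall n, 0 < tau n)
  (balance : exists c0 C0 : R, [/\ 0 < c0, c0 <= C0 &
     forall n, c0 * h n ^+ 2 <= tau n ^+ (2 * q - 1) <= C0 * h n ^+ 2])
  (g1 : R * R -> R[i])
  (g1_trig : trigpoly g1) (g1_gt0 : forall x, 0 < g1 x)
  (M K : forall n, 'M[R]_(n * n))
  (M_spd : forall n, spd (M n))
  (M_toep : forall n, map_mx (real_complex R) (M n) = toeplitz2 n g1)
  (K_toep : forall n, map_mx (real_complex R) (h n ^+ 2 *: K n)
                      = toeplitz2 n (@laplace_symbol R)) :
  let PA n := invmx (stage_mx L (M n) (K n) (tau n))
              *m stage_mx (invmx (collocation_mx c)) (M n) (K n) (tau n) in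
  [/\ symbol_pinfty (fun n => tau n *: (invmx (M n) *m K n)),
      spectral_dist_one PA &
      clustered_at_one PA].
Proof.
move=> PA.
have [b b_ge0 Mle] := toeplitz2_form_bounded g1_trig.
have small (A : R) : 0 <= A -> \forall n \near \oo, A * h n ^+ 2 < 2 * tau n.
  move=> A_ge0; have [c0 [C0 [c0_gt0 _ bal]]] := balance.
  apply: (balance_small (p := (2 * q - 1)%N) (c0 := c0)) => //; first by lia.
  by move=> n; case/andP: (bal n).
have diag n : exists2 V : 'M[R[i]]_(n * n), V \in unitmx &
    exists d : 'rV[R]_(n * n),
    V *m map_mx (real_complex R) (M n) *m V^t* = 1%:M /\
    V *m map_mx (real_complex R) (K n) *m V^t* = diag_mx (map_mx (real_complex R) d).
  by apply: simultaneous_diag => //; exact: (stiffness_sym (h_gt0 n) (K_toep n)).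
(* The quantifier over [V] and [d] comes after the one over [n], so that how large [n] must be does
   not depend on the diagonalization chosen for each [n]. *)
have pencil_count r l : 0 <= r -> (0 < l)%N -> \forall n \near \oo,
  forall (V : 'M[R[i]]_(n * n)) (d : 'rV[R]_(n * n)),
    V *m map_mx (real_complex R) (M n) *m V^t* = 1%:M ->
    V *m map_mx (real_complex R) (K n) *m V^t* = diag_mx (map_mx (real_complex R) d) ->
    (#|[pred i | (tau n * d 0 i <= r)%R]| <= n * (n %/ l).+1)%N.
  move=> r_ge0 l_gt0; near=> n => V d VMV VKV.
  apply: (laplace_pencil_count_le (h_gt0 n) (K_toep n) VMV VKV (b := b)) => //.
    by move=> x; apply: Mle => //; case: (M_spd n).
  by near: n; apply: small; rewrite !mulr_ge0// exprn_ge0.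
have clustered : clustered_at_one PA.
  move=> eps eps_gt0; apply: sparse_count_density; first exact: ltnW.
  move=> l l_gt0; pose A := invmx (collocation_mx c).
  have r_ge0 : 0 <= entry_sum (A - L) / eps + entry_sum L.
    by rewrite addr_ge0 ?divr_ge0 ?entry_sum_ge0// ltW.
  near=> n; have [V Vunit [d [VMV VKV]]] := diag n.
  have [_ L_trig L_diag _ _] := hLU.
  have d_ge0 i := pencil_eigenvalue_ge0 (h_gt0 n) (K_toep n) VKV i.
  apply: leq_trans (preconditioned_count (invmx (collocation_mx c)) (ltnW hq)
    L_trig L_diag (tau_gt0 n) Vunit VMV VKV d_ge0 eps_gt0) _.
  rewrite leq_mul2l; apply/orP; right; move: V d VMV VKV {Vunit d_ge0}.
  by near: n; exact: pencil_count.
split=> //; last first.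
  apply: clustered_spectral_dist => //; near=> n.
  rewrite !muln_gt0 (ltnW hq) /= andbb.
  by near: n; exact: nbhs_infty_gt.
move=> r r_gt0.
pose u n := count (fun z => complex.Re z <= r)
  (eigenvalues (tau n *: (invmx (M n) *m K n))).
(* The factor 1 puts the count in the form of [sparse_count_density] with a single stage. *)
have u_cvg : (u n)%:R / (1 * (n * n))%:R @[n --> \oo] --> (0 : R); last first.
  by apply: cvg_trans u_cvg; apply: near_eq_cvg; near=> n; rewrite mul1n.
apply: sparse_count_density => // l l_gt0.
near=> n; have [V Vunit [d [VMV VKV]]] := diag n.
rewrite mul1n /u (permP (pencil_eigenvalues _ (M_spd n) Vunit VMV VKV)).
rewrite count_map -sum1_count big_enum_cond sum1_card.
move: V d VMV VKV {Vunit}.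
by near: n; apply: pencil_count => //; exact: ltW.
Unshelve. all: by end_near.
Qed.
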